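(* Let $n\ge1$, let $f:[0,1]^n\to\mathbb{R}$ be twice continuously differentiable in $(0,1)^n$, such that $f$ and all its first and second order derivatives extend continuously to the boundary, and let $$F:=\log\sum_{x\in\{0,1\}^n}e^{f(x)}.$$ Let $a,b_i,c_{ij}$, $\mathcal{D}(\cdot)$ and $I$ be as defined in the context. Then for any $\epsilon>0$, $$F\le\sup_{x\in[0,1]^n}(f(x)-I(x))+\mathcal{T}_1+\mathcal{T}_2,$$ where the complexity term $\mathcal{T}_1$ and the smoothness term $\mathcal{T}_2$ are $$\mathcal{T}_1=\frac14\Big(n\sum_{i=1}^nb_i^2\Big)^{1/2}\epsilon+3n\epsilon+\log|\mathcal{D}(\epsilon)|,$$ $$\mathcal{T}_2=4\biggl(\sum_{i=1}^n(ac_{ii}+b_i^2)+\frac14\sum_{i,j=1}^n\bigl(ac_{ij}^2+b_ib_jc_{ij}+4b_ic_{ij}\bigr)\biggr)^{1/2}+\frac14\Big(\sum_{i=1}^nb_i^2\Big)^{1/2}\Big(\sum_{i=1}^nc_{ii}^2\Big)^{1/2}+3\sum_{i=1}^nc_{ii}+\log2.$$ Moreover, $$F\ge\sup_{x\in[0,1]^n}(f(x)-I(x))-\frac12\sum_{i=1}^nc_{ii}.$$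
   Context: $\|g\|$ denotes the supremum norm of a function $g$ on $[0,1]^n$. For the given $f$, $f_i:=\partial f/\partial x_i$, $f_{ij}:=\partial^2 f/\partial x_i\partial x_j$, and $a:=\|f\|$, $b_i:=\|f_i\|$, $c_{ij}:=\|f_{ij}\|$. For each $\epsilon>0$, $\mathcal{D}(\epsilon)$ is a finite subset of $\mathbb{R}^n$ such that for all $x\in\{0,1\}^n$ there exists $d=(d_1,\ldots,d_n)\in\mathcal{D}(\epsilon)$ with $\sum_{i=1}^n(f_i(x)-d_i)^2\le n\epsilon^2$. For $u\in[0,1]$, $I(u):=u\log u+(1-u)\log(1-u)$ (with $0\log0=0$), and for $x\in[0,1]^n$, $I(x):=\sum_{i=1}^nI(x_i)$. *)

(* Defs.v *)
From HB Require Import structures.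
From mathcomp Require Import all_boot all_order all_algebra.
From mathcomp Require Import finmap.
From mathcomp Require Import all_classical all_reals all_analysis.

Set Implicit Arguments.
Unset Strict Implicit.
Unset Printing Implicit Defensive.

Import Order.TTheory GRing.Theory Num.Theory.
Import numFieldNormedType.Exports.

Local Open Scope classical_set_scope.
Local Open Scope ring_scope.

Section Defs.
Context {R : realType} {n : nat}.
Implicit Types (f g h : 'rV[R]_n -> R) (x : 'rV[R]_n) (i j : 'I_n).

Definition cube : set 'rV[R]_n := [set x | forall i, 0 <= x 0 i <= 1].

Definition open_cube : set 'rV[R]_n := [set x | forall i, 0 < x 0 i < 1].

(* A function on [0,1]^n is represented by a function on 'rV[R]_n; its values
   outside the cube never matter. *)
Definition supnorm g : R := sup [set `|g x| | x in cube].

Definition partial i f : 'rV[R]_n -> R := fun x => 'D_(delta_mx 0 i) f x.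

Definition has_partial i f : Prop :=
  {in open_cube, forall x, derivable f x (delta_mx 0 i)}.

(* [h] is, on the closed cube, the continuous extension of the restriction of
   [g] to the open cube (unique, the open cube being dense in the closed one). *)
Definition continuous_extension g h : Prop :=
  {in open_cube, forall x, h x = g x} /\ {within cube, continuous h}.

(* [f] is C^2 in (0,1)^n, [f] is continuous on [0,1]^n, and its derivatives
   df/dx_i and d^2f/dx_idx_j extend continuously to [0,1]^n, with extensions
   [f1 i] and [f2 i j]. Continuity of the derivatives in the open cube follows
   from that of their extensions. *)
Definition C2_cube f (f1 : 'I_n -> 'rV[R]_n -> R)
    (f2 : 'I_n -> 'I_n -> 'rV[R]_n -> R) : Prop :=
  [/\ {within cube, continuous f},
      forall i, has_partial i f,
      forall i, continuous_extension (partial i f) (f1 i),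
      forall i j, has_partial i (partial j f)
    & forall i j, continuous_extension (partial i (partial j f)) (f2 i j)].

Definition vertex (s : {ffun 'I_n -> bool}) : 'rV[R]_n := \row_i (s i)%:R.

Definition log_partition f : R :=
  ln (\sum_(s : {ffun 'I_n -> bool}) expR (f (vertex s))).

(* [ln 0 = 0] in the library, so [0 * ln 0 = 0]. *)
Definition entropy1 (u : R) : R := u * ln u + (1 - u) * ln (1 - u).

Definition entropy x : R := \sum_i entropy1 (x 0 i).

Definition variational_sup f : R := sup [set f x - entropy x | x in cube].

Definition gradient_net (f1 : 'I_n -> 'rV[R]_n -> R)
    (D : R -> {fset 'rV[R]_n}) : Prop :=
  forall eps : R, 0 < eps -> forall s : {ffun 'I_n -> bool},
    exists2 d, d \in D eps &
      \sum_i (f1 i (vertex s) - d 0 i) ^+ 2 <= n%:R * eps ^+ 2.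

Definition complexity_term (b : 'I_n -> R) (D : R -> {fset 'rV[R]_n})
    (eps : R) : R :=
  4^-1 * Num.sqrt (n%:R * \sum_i b i ^+ 2) * eps + 3 * n%:R * eps
  + ln (#|` D eps|%:R).

Definition smoothness_term (a : R) (b : 'I_n -> R) (c : 'I_n -> 'I_n -> R) : R :=
  4 * Num.sqrt (\sum_i (a * c i i + b i ^+ 2)
                + 4^-1 * \sum_i \sum_j (a * c i j ^+ 2 + b i * b j * c i j
                                        + 4 * b i * c i j))
  + 4^-1 * Num.sqrt (\sum_i b i ^+ 2) * Num.sqrt (\sum_i c i i ^+ 2)
  + 3 * \sum_i c i i + ln 2.

End Defs.

(* Main.v *)
(* Let X have law mu proportional to e^f on {0,1}^n and let p(X)_i be the
   conditional mean of X_i given the other coordinates, i.e. the sigmoid of the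
   discrete derivative D_i f(X).

   Upper bound: by Gibbs' inequality F <= E[f(X) - ln q(X)] for every law q.
   Take for q the uniform mixture, over d in D(eps), of the product measures
   with means sigmoid(d_i). Up to n eps + sum_i c_ii + ln |D(eps)|, -ln q(X)
   is at most -I(p(X)) - sum_i (X_i - p_i) D_i f, and the last sum has mean 0
   because p_i and D_i f do not depend on X_i. It remains to bound
   E[f(X) - f(p(X))]. Moving from p(X) to X one coordinate at a time and
   conditioning on the other coordinates, it is at most
   S = sum_k (c_kk/2 + sum_j c_jk c_kj/4); it is trivially at most 2a, hence at
   most sqrt(2aS), which the smoothness term absorbs. Only first moments
   are needed.

   Lower bound: Gibbs' inequality for the product measure with means x, whose
   mean error is at most sum_k c_kk/2 by the same coordinate-wise argument. *)
Require Import Defs.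
From HB Require Import structures.
From mathcomp Require Import all_boot all_order all_algebra.
From mathcomp Require Import finmap.
From mathcomp Require Import all_classical all_reals all_analysis.
From mathcomp Require Import ring lra.
Set Implicit Arguments.
Unset Strict Implicit.
Unset Printing Implicit Defensive.
Import Order.TTheory GRing.Theory Num.Theory.
Import numFieldNormedType.Exports.
Local Open Scope classical_set_scope.
Local Open Scope ring_scope.

(** * Increments along coordinate lines of the closed cube, from derivatives in the open cube *)

Section CubeAnalysis.
Context {R : realType} {n : nat}.
Implicit Types (f g h : 'rV[R]_n -> R) (x y z : 'rV[R]_n) (i j k : 'I_n).

Definition update x j (t : R) : 'rV[R]_n :=
  \row_i (if i == j then t else x 0 i).

Lemma updateE x j t i : update x j t 0 i = if i == j then t else x 0 i.
Proof. by rewrite mxE. Qed.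

Lemma update_cube x j t : cube x -> 0 <= t <= 1 -> cube (update x j t).
Proof. by move=> cx ct i; rewrite updateE; case: eqP. Qed.

Lemma update_open_cube x j t :
  open_cube x -> 0 < t < 1 -> open_cube (update x j t).
Proof. by move=> cx ct i; rewrite updateE; case: eqP. Qed.

Lemma open_cubeW x : open_cube x -> cube x.
Proof. by move=> cx i; have /andP[/ltW -> /ltW ->] := cx i. Qed.

Lemma cube_compact : compact (cube : set 'rV[R]_n).
Proof.
have := @rV_compact R n (fun=> `[0, 1]%classic) (fun=> @segment_compact R 0 1).
congr compact; apply/seteqP; split => x /= cx i; have := cx i;
  by rewrite /= in_itv.
Qed.

Lemma cube_neq0 : (cube : set 'rV[R]_n) !=set0.
Proof. by exists 0 => i; rewrite mxE lexx ler01. Qed.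

(** Compactness of the cube bounds the values of [g], so that [sup] is a genuine supremum. *)
Lemma supnorm_ge g x : {within cube, continuous g} -> cube x ->
  `|g x| <= supnorm g.
Proof.
move=> cg cx; apply: ub_le_sup; last by exists x.
have cng : {within cube, continuous (fun x => `|g x|)}.
  by move=> y; apply: continuous_comp; [exact: cg|exact: norm_continuous].
have /compact_has_sup : compact [set `|g x| | x in cube].
  exact: continuous_compact cng cube_compact.
by case=> //; exists `|g x|, x.
Qed.

Lemma supnorm_ge0 g : {within cube, continuous g} -> 0 <= supnorm g.
Proof.
move=> cg; have [x cx] := cube_neq0.
exact: le_trans (normr_ge0 _) (supnorm_ge cg cx).
Qed.

(** Homothety of ratio [1 - r] about the centre of the cube; it sends coordinate lines to coordinate
    lines. *)
Definition shrink (r : R) x : 'rV[R]_n := x + r *: (const_mx 2^-1 - x).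

Lemma shrinkE r x i : shrink r x 0 i = x 0 i + r * (2^-1 - x 0 i).
Proof. by rewrite !mxE. Qed.

Lemma shrink_open_cube r x : 0 < r <= 1 -> cube x -> open_cube (shrink r x).
Proof.
move=> /andP[r0 r1] cx i; rewrite shrinkE; have /andP[x0 x1] := cx i.
apply/andP; split; nra.
Qed.

Lemma shrink_update r x j t :
  shrink r (update x j t) = update (shrink r x) j (t + r * (2^-1 - t)).
Proof.
apply/rowP => i; rewrite shrinkE !updateE.
by case: eqP => // _; rewrite shrinkE.
Qed.

Lemma harmonic_le1 (m : nat) : 0 < (harmonic m : R) <= 1.
Proof. by rewrite /harmonic /= invr_gt0 ltr0Sn invf_le1 ?ltr0Sn// ler1n. Qed.

Lemma cvg_shrink g x : {within cube, continuous g} -> cube x ->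
  g (shrink (harmonic m) x) @[m --> \oo] --> g x.
Proof.
move=> /subspace_continuousP cg cx.
have sx : shrink (harmonic m) x @[m --> \oo] --> x.
  rewrite -[X in _ --> X]addr0 -(scale0r (const_mx 2^-1 - x)).
  apply: cvgD; first exact: cvg_cst.
  by apply: cvgZr_tmp; exact: cvg_harmonic.
apply: cvg_trans (cg _ cx) => P /= gP.
have := sx _ gP; rewrite /nbhs /=; apply: filterS => m; apply.
by apply/open_cubeW/shrink_open_cube => //; exact: harmonic_le1.
Qed.

(** Moving coordinate [j] by [h] is translation by [h] times a basis vector, so the two difference
    quotients coincide. *)
Lemma is_derive_fiber g j x t :
  derivable g (update x j t) (delta_mx 0 j) ->
  is_derive t 1 (fun r => g (update x j r)) (partial j g (update x j t)).
Proof.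
have E : (fun h : R => h^-1 *: (g (update x j (h *: 1 + t)) - g (update x j t)))
       = (fun h : R => h^-1 *: (g (h *: delta_mx 0 j + update x j t) -
                                g (update x j t))).
  apply/funext => h; congr (_ *: (g _ - _)); apply/rowP => i.
  rewrite !mxE /=; case: (i == j); rewrite /= ?mulr1 ?mulr0 ?add0r//.
  by rewrite /GRing.scale /= mulr1.
move=> dg; apply: DeriveDef; first by rewrite /derivable/= E.
by rewrite /derive /= E.
Qed.

(** Mean value theorem for the single function [phi], whose increment is the whole quantity to be
    bounded; both sides are symmetric in [s] and [t]. *)
Lemma fiber_increment_open g j x y (kappa K M s t : R) : has_partial j g ->
  open_cube x -> open_cube y -> 0 < s < 1 -> 0 < t < 1 ->
  (forall r : R, 0 < r < 1 -> `|partial j g (update x j r)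
      - kappa * partial j g (update y j r) - K| <= M) ->
  `|g (update x j t) - g (update x j s)
    - kappa * (g (update y j t) - g (update y j s)) - K * (t - s)|
    <= M * `|t - s|.
Proof.
move=> pg ox oy; wlog st : s t / s < t => [hw s01 t01 hM|].
  have [st|ts|->] := ltgtP s t; first exact: hw.
    rewrite -normrN (distrC t).
    set u := (X in `|X|).
    suff -> : u = g (update x j s) - g (update x j t)
        - kappa * (g (update y j s) - g (update y j t)) - K * (s - t).
      exact: hw.
    by rewrite /u; ring.
  by rewrite !subrr !mulr0 !subrr normr0 mulr0.
move=> s01 t01 hM.
pose phi r := g (update x j r) - kappa * g (update y j r) - K * r.
pose dphi r := partial j g (update x j r)
  - kappa * partial j g (update y j r) - K.
have itv01 (r : R) : r \in `[s, t] -> 0 < r < 1.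
  rewrite in_itv /= => /andP[sr rt].
  move: s01 t01 => /andP[s0 _] /andP[_ t1].
  by rewrite (lt_le_trans s0 sr) (le_lt_trans rt t1).
have dg (r : R) z : 0 < r < 1 -> open_cube z ->
    is_derive r 1 (fun r => g (update z j r)) (partial j g (update z j r)).
  move=> r01 oz; apply: is_derive_fiber; apply: pg.
  by rewrite inE; exact: update_open_cube.
have dphiP (r : R) : r \in `[s, t] -> is_derive r 1 phi (dphi r).
  move=> /itv01 r01; have dx := dg _ _ r01 ox; have dy := dg _ _ r01 oy.
  rewrite /phi /dphi.
  have := is_deriveB (is_deriveB dx (is_deriveZ kappa dy))
    (is_deriveZ K (is_derive_id r 1)).
  rewrite /GRing.scale /= mulr1; exact.
have dphi_oo (r : R) : r \in `]s, t[ -> is_derive r 1 phi (dphi r).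
  by move=> rst; apply: dphiP; exact: subset_itv_oo_cc rst.
have cphi : {within `[s, t], continuous phi}.
  by apply: derivable_within_continuous => r /dphiP [].
have [r rst E] := MVT st dphi_oo cphi.
have -> : g (update x j t) - g (update x j s)
    - kappa * (g (update y j t) - g (update y j s)) - K * (t - s)
    = phi t - phi s by rewrite /phi; ring.
rewrite E normrM ler_wpM2r//; apply: hM; apply: itv01.
exact: subset_itv_oo_cc rst.
Qed.

(* Derivatives are given in the open cube only: the estimate is proved for the
   points shrunk towards the centre of the cube, and then passed to the limit.
   The pairs (kappa, lambda) = (0, 0), (0, 1) and (1, 0) give a Lipschitz bound,
   a first order Taylor bound and a bound on mixed differences. *)
Lemma fiber_increment_le g0 g h j x y w (kappa lambda M s t : R) :
  continuous_extension g0 g -> has_partial j g0 ->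
  continuous_extension (partial j g0) h ->
  cube x -> cube y -> cube w -> 0 <= s <= 1 -> 0 <= t <= 1 ->
  (forall r c : R, 0 < r <= 1 -> 0 < c < 1 ->
    `|h (update (shrink r x) j c) - kappa * h (update (shrink r y) j c)
      - lambda * h (shrink r w)| <= M) ->
  `|g (update x j t) - g (update x j s)
    - kappa * (g (update y j t) - g (update y j s)) - lambda * h w * (t - s)|
    <= M * `|t - s|.
Proof.
move=> [gE cg] pg [hE ch] cx cy cw s01 t01 hM.
(* The sign of [M] comes from one instance of the bound; the midpoint is an arbitrary choice. *)
have M0 : 0 <= M.
  apply: le_trans (normr_ge0 _) (hM 1 2^-1 _ _); first by rewrite ltr01 lexx.
  by apply/andP; split; lra.
pose inc (m : nat) z := g (shrink (harmonic m) (update z j t)) -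
                g (shrink (harmonic m) (update z j s)).
pose d (m : nat) : R := (t - s) - harmonic m * (t - s).
have cvg_inc z : cube z ->
    inc m z @[m --> \oo] --> g (update z j t) - g (update z j s).
  by move=> cz; apply: cvgB; apply: cvg_shrink => //; exact: update_cube.
have cvg_d : d m @[m --> \oo] --> t - s.
  rewrite -[X in _ --> X]subr0 -[X in _ - X](mul0r (t - s)).
  apply: cvgB; first exact: cvg_cst.
  by apply: cvgMl; exact: cvg_harmonic.
pose u m := inc m x - kappa * inc m y
  - lambda * h (shrink (harmonic m) w) * d m.
have cvg_u : `|u m| @[m --> \oo] -->
    `|g (update x j t) - g (update x j s)
    - kappa * (g (update y j t) - g (update y j s)) - lambda * h w * (t - s)|.
  apply: cvg_norm; apply: cvgB.
    by apply: cvgB; [exact: cvg_inc|apply: cvgMr; exact: cvg_inc].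
  by apply: cvgM => //; apply: cvgMr; exact: cvg_shrink.
apply: (ler_cvg_to cvg_u (cvg_cst (M * `|t - s|))).
near=> m.
have r01 := harmonic_le1 m; rewrite /u /inc !shrink_update.
have tsE : d m = (t + harmonic m * (2^-1 - t)) - (s + harmonic m * (2^-1 - s)).
  by rewrite /d; ring.
have in01 (v : R) : 0 <= v <= 1 -> 0 < v + harmonic m * (2^-1 - v) < 1.
  move: r01 => /andP[r0 r1] /andP[v0 v1].
  by apply/andP; split; nra.
(* Shrinking multiplies [t - s] by [1 - harmonic m], a factor in [0,1], so the bound for shrunk
   points implies the one wanted. *)
apply: (@le_trans _ _ (M * `|d m|)); last first.
  apply: ler_wpM2l => //.
  have -> : d m = (1 - harmonic m) * (t - s) by rewrite /d; ring.
  rewrite normrM ler_piMl// ger0_norm; move: r01 => /andP[r0 r1]; lra.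
have opn z (v : R) : cube z -> 0 <= v <= 1 ->
    update (shrink (harmonic m) z) j (v + harmonic m * (2^-1 - v))
      \in open_cube.
  move=> cz v01; rewrite inE; apply: update_open_cube; last exact: in01.
  exact: shrink_open_cube.
rewrite tsE !gE; try exact: opn.
apply: fiber_increment_open => //.
- exact: shrink_open_cube.
- exact: shrink_open_cube.
- exact: in01.
- exact: in01.
move=> c c01; rewrite -!hE; first exact: hM.
  by rewrite inE; apply: update_open_cube => //; exact: shrink_open_cube.
by rewrite inE; apply: update_open_cube => //; exact: shrink_open_cube.
Unshelve. all: by end_near. Qed.

Lemma fiber_lipschitz g0 g h j x (s t : R) :
  continuous_extension g0 g -> has_partial j g0 ->
  continuous_extension (partial j g0) h ->
  cube x -> 0 <= s <= 1 -> 0 <= t <= 1 ->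
  `|g (update x j t) - g (update x j s)| <= supnorm h * `|t - s|.
Proof.
move=> cg pg hP cx s01 t01.
have := @fiber_increment_le g0 g h j x x x 0 0 (supnorm h) s t cg pg hP cx cx cx
  s01 t01.
rewrite !mul0r !subr0; apply => r c r01 c01; rewrite !mul0r !subr0.
apply: supnorm_ge; first by case: hP.
by apply/open_cubeW/update_open_cube => //; exact: shrink_open_cube.
Qed.

(** A path from [z] (at [k = 0]) to [y] (at [k = n]) that changes one coordinate per step. *)
Definition hybrid y z (k : nat) : 'rV[R]_n :=
  \row_i (if (i < k)%N then y 0 i else z 0 i).

Lemma hybrid_cube y z k : cube y -> cube z -> cube (hybrid y z k).
Proof. by move=> cy cz i; rewrite mxE; case: ifP. Qed.

Lemma hybridS y z (k : 'I_n) : hybrid y z k.+1 =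
  update (hybrid y z k) k (y 0 k).
Proof.
apply/rowP => i; rewrite updateE !mxE ltnS leq_eqVlt.
have [/val_inj->|ne] := eqVneq (i : nat) k; rewrite ?eqxx//.
by rewrite -val_eqE (negPf ne).
Qed.

Lemma hybrid_fix y z (k : 'I_n) :
  hybrid y z k = update (hybrid y z k) k (z 0 k).
Proof.
apply/rowP => i; rewrite updateE !mxE.
by case: eqP => // ->; rewrite ltnn.
Qed.

Lemma telescope_hybrid g y z :
  g y - g z = \sum_(k < n) (g (update (hybrid y z k) k (y 0 k))
                      - g (update (hybrid y z k) k (z 0 k))).
Proof.
have -> : g y - g z = g (hybrid y z n) - g (hybrid y z 0).
  by congr (g _ - g _); apply/rowP => i; rewrite mxE ?ltn_ord ?ltn0.
rewrite -(telescope_sumr (fun m : nat => g (hybrid y z m)) (leq0n n)) big_mkord.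
by apply: eq_bigr => k _; rewrite hybridS -hybrid_fix.
Qed.

Lemma cube_lipschitz g0 g (h : 'I_n -> 'rV[R]_n -> R) y z :
  continuous_extension g0 g -> (forall j, has_partial j g0) ->
  (forall j, continuous_extension (partial j g0) (h j)) ->
  cube y -> cube z ->
  `|g y - g z| <= \sum_j supnorm (h j) * `|y 0 j - z 0 j|.
Proof.
move=> cg pg hP cy cz; rewrite telescope_hybrid.
apply: le_trans (ler_norm_sum _ _ _) _; apply: ler_sum => j _.
by apply: fiber_lipschitz (pg j) (hP j) _ _ _ => //; exact: hybrid_cube.
Qed.

End CubeAnalysis.

(** * Second order estimates in terms of the norms of the second derivatives *)

Section C2Estimates.
Context {R : realType} {n : nat}.
Variables (f : 'rV[R]_n -> R) (f1 : 'I_n -> 'rV[R]_n -> R)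
  (f2 : 'I_n -> 'I_n -> 'rV[R]_n -> R).
Hypothesis fC2 : C2_cube f f1 f2.
Implicit Types (x y z : 'rV[R]_n) (i j k : 'I_n).
Let c i j := supnorm (f2 i j).

Lemma C2_continuous : {within cube, continuous f}.
Proof. by case: fC2. Qed.

Lemma C2_partial_continuous i : {within cube, continuous (f1 i)}.
Proof. by case: fC2 => _ _ f1P _ _; have [] := f1P i. Qed.

Lemma C2_norm_ge0 i j : 0 <= c i j.
Proof. by apply: supnorm_ge0; case: fC2 => _ _ _ _ /(_ i j)[]. Qed.

Lemma C2_partial_lipschitz k x z : cube x -> cube z ->
  `|f1 k x - f1 k z| <= \sum_j c j k * `|x 0 j - z 0 j|.
Proof.
by case: fC2 => _ _ f1P pf2 f2P; apply: cube_lipschitz (f1P k) _ _.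
Qed.

(** Case [kappa = 0], [lambda = 1]. The slope is taken at [w], possibly off the line: coordinate [k]
    differs by at most 1 and costs [c k k], the others cost their distance to [w]. *)
Lemma C2_fiber_increment k x w (s t : R) : cube x -> cube w ->
  0 <= s <= 1 -> 0 <= t <= 1 ->
  `|f (update x k t) - f (update x k s) - f1 k w * (t - s)|
  <= (c k k + \sum_j c j k * `|x 0 j - w 0 j|) * `|t - s|.
Proof.
move=> cx cw s01 t01; case: (fC2) => cf pf f1P _ _.
have := @fiber_increment_le _ _ f f (f1 k) k x x w 0 1
  (c k k + \sum_j c j k * `|x 0 j - w 0 j|) s t (conj (fun _ _ => erefl) cf)
  (pf k) (f1P k) cx cx cw s01 t01.
rewrite mul0r subr0 mul1r; apply => r e r01 e01; rewrite mul0r subr0 mul1r.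
have osx : open_cube (shrink r x) by exact: shrink_open_cube.
have osw : open_cube (shrink r w) by exact: shrink_open_cube.
apply: le_trans (C2_partial_lipschitz _ _ _) _; [|exact: open_cubeW|].
  exact/open_cubeW/update_open_cube.
rewrite (bigD1 k)//= [in leRHS](bigD1 k)//= addrA; apply: lerD.
  rewrite updateE eqxx -[leLHS]addr0; apply: lerD; last first.
    by rewrite mulr_ge0 ?C2_norm_ge0.
  rewrite ler_piMr ?C2_norm_ge0//.
  have := osw k; move: e01 => /andP[? ?] /andP[? ?].
  by rewrite ler_norml; apply/andP; split; lra.
apply: ler_sum => j jk; apply: ler_wpM2l; first exact: C2_norm_ge0.
rewrite updateE (negPf jk) !shrinkE.
have -> : x 0 j + r * (2^-1 - x 0 j) - (w 0 j + r * (2^-1 - w 0 j)) =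
  (1 - r) * (x 0 j - w 0 j) by ring.
move: r01 => /andP[r0 r1].
by rewrite normrM ler_piMl// ger0_norm; lra.
Qed.

(** Case [kappa = 1], [lambda = 0]. The two slopes are compared at equal values of coordinate [k],
    so no separate [c k k] appears. *)
Lemma C2_mixed_increment k x y (s t : R) : cube x -> cube y ->
  0 <= s <= 1 -> 0 <= t <= 1 ->
  `|f (update x k t) - f (update x k s)
    - (f (update y k t) - f (update y k s))|
  <= (\sum_j c j k * `|x 0 j - y 0 j|) * `|t - s|.
Proof.
move=> cx cy s01 t01; case: (fC2) => cf pf f1P _ _.
have := @fiber_increment_le _ _ f f (f1 k) k x y x 1 0
  (\sum_j c j k * `|x 0 j - y 0 j|) s t (conj (fun _ _ => erefl) cf)
  (pf k) (f1P k) cx cy cx s01 t01.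
rewrite mul0r mul0r subr0 mul1r; apply => r e r01 e01.
rewrite mul0r subr0 mul1r.
have osx : open_cube (shrink r x) by exact: shrink_open_cube.
have osy : open_cube (shrink r y) by exact: shrink_open_cube.
apply: le_trans (C2_partial_lipschitz _ _ _) _;
  try exact/open_cubeW/update_open_cube.
apply: ler_sum => j _; apply: ler_wpM2l; first exact: C2_norm_ge0.
rewrite !updateE; case: eqP => [_|_]; first by rewrite subrr normr0.
rewrite !shrinkE.
have -> : x 0 j + r * (2^-1 - x 0 j) - (y 0 j + r * (2^-1 - y 0 j)) =
  (1 - r) * (x 0 j - y 0 j) by ring.
move: r01 => /andP[r0 r1].
by rewrite normrM ler_piMl// ger0_norm; lra.
Qed.

End C2Estimates.

(** * Gibbs' inequality on a finite set *)

Section Discrete.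
Context {R : realType}.

Lemma ln_leB1 (u : R) : 0 < u -> ln u <= u - 1.
Proof. by move=> u0; rewrite -[in leLHS](subrKC 1 u) le_ln1Dx//; lra. Qed.

(** Use [ln t <= t - 1] at [t = expR (g s) / (Z * q s)] in each term with [q s > 0]; the corrections
    [expR (g s) / Z - q s] sum to 0. *)
Lemma gibbs_variational (T : finType) (q g : T -> R) :
  (forall s, 0 <= q s) -> \sum_s q s = 1 ->
  \sum_s q s * (g s - ln (q s)) <= ln (\sum_s expR (g s)).
Proof.
move=> q0 q1; set Z := \sum_s expR (g s).
have Z0 : 0 < Z.
  have [s _|T0] := pickP (fun _ : T => true).
    rewrite /Z (bigD1 s)//= ltr_wpDr ?expR_gt0//.
    by apply: sumr_ge0 => t _; exact: expR_ge0.
  by move: q1; rewrite big_pred0// => /eqP; rewrite eq_sym oner_eq0.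
have le_s s : q s * (g s - ln (q s)) <= q s * ln Z + (expR (g s) / Z - q s).
  have := q0 s; rewrite le_eqVlt => /predU1P[<-|qs0].
    by rewrite !mul0r add0r subr0 divr_ge0 ?expR_ge0// ltW.
  pose t := expR (g s) / (Z * q s).
  have t0 : 0 < t by rewrite divr_gt0 ?expR_gt0// mulr_gt0.
  have lnt : ln t = g s - (ln Z + ln (q s)).
    rewrite /t ln_div ?posrE ?expR_gt0 ?mulr_gt0//.
    by rewrite expRK lnM ?posrE.
  have := ln_leB1 t0.
  rewrite lnt -(ler_pM2l qs0).
  have -> : q s * (t - 1) = expR (g s) / Z - q s.
    by rewrite /t; field; rewrite !gt_eqF.
  lra.
apply: le_trans (ler_sum _ (fun s _ => le_s s)) _.
rewrite big_split/= sumrB -!mulr_suml q1 -/Z divff ?gt_eqF//; lra.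
Qed.

(** * The logistic function and the log-likelihood of one bit *)

Definition sigmoid (u : R) : R := expR u / (1 + expR u).

(** Log-normalizer of the Bernoulli law with mean [sigmoid u]. *)
Definition softplus (u : R) : R := ln (1 + expR u).

Lemma expR1_gt0 (u : R) : 0 < 1 + expR u.
Proof. by rewrite addr_gt0 ?expR_gt0. Qed.

Lemma sigmoidC (u : R) : 1 - sigmoid u = (1 + expR u)^-1.
Proof. by rewrite /sigmoid; field; rewrite gt_eqF ?expR1_gt0. Qed.

Lemma sigmoid_gt0 (u : R) : 0 < sigmoid u.
Proof. by rewrite divr_gt0 ?expR_gt0 ?expR1_gt0. Qed.

Lemma sigmoid_lt1 (u : R) : sigmoid u < 1.
Proof. by rewrite -subr_gt0 sigmoidC invr_gt0 expR1_gt0. Qed.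

Lemma ln_sigmoid (u : R) : ln (sigmoid u) = u - softplus u.
Proof. by rewrite ln_div ?posrE ?expR_gt0 ?expR1_gt0// expRK. Qed.

Lemma ln_sigmoidC (u : R) : ln (1 - sigmoid u) = - softplus u.
Proof. by rewrite sigmoidC lnV ?posrE ?expR1_gt0. Qed.

(** For [v <= u] the difference factors as [sigmoid u], below 1, times
    [(1 - expR (v - u)) / (1 + expR v)], at most [u - v] by convexity of [expR]. *)
Lemma sigmoid_lipschitz (u v : R) :
  `|sigmoid u - sigmoid v| <= `|u - v|.
Proof.
wlog uv : u v / v <= u => [hw|].
  by have [/hw//|/ltW/hw] := leP v u; rewrite distrC (distrC v).
have eu := expR_gt0 u; have ev := expR_gt0 v.
have evu : expR v = expR u * expR (v - u) by rewrite -expRD; congr expR; ring.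
have h := expR_ge1Dx (v - u).
have e1 : expR (v - u) <= 1 by rewrite -expR0 ler_expR; lra.
have -> : sigmoid u - sigmoid v =
    (expR u / (1 + expR u)) * ((1 - expR (v - u)) / (1 + expR v)).
  rewrite /sigmoid evu; field.
  by rewrite -evu !gt_eqF ?expR1_gt0.
rewrite (ger0_norm (_ : 0 <= u - v)); last lra.
rewrite ger0_norm; last first.
  by rewrite mulr_ge0 ?divr_ge0//; lra.
apply: (@le_trans _ _ (1 * ((1 - expR (v - u)) / (1 + expR v)))).
  apply: ler_wpM2r; first by rewrite divr_ge0; lra.
  exact/ltW/sigmoid_lt1.
rewrite mul1r ler_pdivrMr; last lra.
nra.
Qed.

Lemma softplus_lipschitz (u v : R) :
  `|softplus u - softplus v| <= `|u - v|.
Proof.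
wlog uv : u v / v <= u => [hw|].
  by have [/hw//|/ltW/hw] := leP v u; rewrite distrC (distrC v).
have euv : expR v <= expR u by rewrite ler_expR.
have le1 : softplus v <= softplus u.
  by rewrite /softplus ler_ln ?posrE ?expR1_gt0// lerD2l.
rewrite !ger0_norm; try lra.
suff : softplus u <= (u - v) + softplus v by lra.
rewrite /softplus -[u - v]expRK -lnM ?posrE ?expR_gt0 ?expR1_gt0//.
rewrite ler_ln ?posrE ?mulr_gt0 ?expR_gt0 ?expR1_gt0// mulrDr mulr1 -expRD.
rewrite subrK lerD2r; have := expR_ge1Dx (u - v); lra.
Qed.

Definition bernoulli_mass (p : R) (b : bool) : R := if b then p else 1 - p.

Lemma ln_bernoulli_sigmoid (u : R) b :
  ln (bernoulli_mass (sigmoid u) b) = b%:R * u - softplus u.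
Proof.
case: b => /=; first by rewrite mul1r ln_sigmoid.
by rewrite ln_sigmoidC mul0r add0r.
Qed.

(** The increment of [softplus] has the sign of [u - v] and is no larger, so subtracting it from
    [u - v] (the case [b = true]) keeps the constant 1. *)
Lemma ln_bernoulli_sigmoid_lipschitz (u v : R) b :
  `|ln (bernoulli_mass (sigmoid u) b) - ln (bernoulli_mass (sigmoid v) b)|
  <= `|u - v|.
Proof.
rewrite !ln_bernoulli_sigmoid; have := softplus_lipschitz u v.
have [uv|/ltW uv] := leP v u.
  have : softplus v <= softplus u.
    by rewrite /softplus ler_ln ?posrE ?expR1_gt0// lerD2l ler_expR.
  move=> ?; rewrite !(ger0_norm (_ : 0 <= u - v)); last lra.
  rewrite !ler_norml => /andP[? ?].
  by case: b; rewrite ?mul1r ?mul0r; apply/andP; split; lra.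
have : softplus u <= softplus v.
  by rewrite /softplus ler_ln ?posrE ?expR1_gt0// lerD2l ler_expR.
move=> ?; rewrite !(ler0_norm (_ : u - v <= 0)); last lra.
rewrite !ler_norml => /andP[? ?].
by case: b; rewrite ?mul1r ?mul0r; apply/andP; split; lra.
Qed.

Lemma entropy1_sigmoid (u : R) :
  entropy1 (sigmoid u) = sigmoid u * u - softplus u.
Proof. by rewrite /entropy1 ln_sigmoid ln_sigmoidC; ring. Qed.

(** * Averaging over one bit at a time *)

Context {n : nat}.
Implicit Types (s : {ffun 'I_n -> bool}) (i j k : 'I_n).

Definition set_bit s k b : {ffun 'I_n -> bool} :=
  [ffun i => if i == k then b else s i].

Lemma set_bitK s k b b' : set_bit (set_bit s k b) k b' = set_bit s k b'.
Proof. by apply/ffunP => i; rewrite !ffunE; case: eqP. Qed.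

Lemma vertex_set_bit s k b :
  vertex (set_bit s k b) = update (vertex s) k b%:R :> 'rV[R]_n.
Proof. by apply/rowP => i; rewrite !mxE ffunE; case: eqP. Qed.

Lemma vertex_cube s : cube (vertex s : 'rV[R]_n).
Proof. by move=> i; rewrite mxE; case: (s i); rewrite ?lexx ?ler01. Qed.

(** Flipping bit [k] is an involution, and each summand on the left is [H] at [s] plus [H] at its
    flip. *)
Lemma sum_set_bit (H : {ffun 'I_n -> bool} -> R) k :
  \sum_s (H (set_bit s k true) + H (set_bit s k false)) = 2 * \sum_s H s.
Proof.
pose flip s := set_bit s k (~~ s k).
have flipK : involutive flip.
  move=> s; rewrite /flip set_bitK; apply/ffunP => i; rewrite !ffunE eqxx negbK.
  by case: eqP => // ->.
have E s : H (set_bit s k true) + H (set_bit s k false) = H s + H (flip s).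
  have {3}<- : set_bit s k (s k) = s.
    by apply/ffunP => i; rewrite ffunE; case: eqP => // ->.
  by rewrite /flip; case: (s k) => //; rewrite addrC.
rewrite (eq_bigr _ (fun s _ => E s)) big_split/=.
have <- : \sum_s H s = \sum_s H (flip s) by exact: reindex_inj (inv_inj flipK).
ring.
Qed.

Section Conditional.
Variable (w : {ffun 'I_n -> bool} -> R) (p : {ffun 'I_n -> bool} -> 'rV[R]_n).
Hypothesis w_ge0 : forall s, 0 <= w s.
Hypothesis p_cube : forall s, cube (p s).
Hypothesis p_set_bit : forall s k b, p (set_bit s k b) 0 k = p s 0 k.
(* Under weights [w], [p s 0 k] is the conditional probability of bit [k] given
   the other bits, written without division. *)
Hypothesis p_conditional : forall s k,
  w (set_bit s k true) * (1 - p s 0 k) = w (set_bit s k false) * p s 0 k.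

(** Each pair of configurations differing in bit [k] contributes its total weight times the
    conditional mean of [G], so bounding conditional means suffices. *)
Lemma sum_conditional_le (G : {ffun 'I_n -> bool} -> R) k (C : R) :
  (forall s, `|p s 0 k * G (set_bit s k true)
               + (1 - p s 0 k) * G (set_bit s k false)| <= C) ->
  `|\sum_s w s * G s| <= C * \sum_s w s.
Proof.
move=> hC; rewrite -(ler_pM2l (ltr0Sn _ 1 : 0 < 2 :> R)).
have -> : 2 * `|\sum_s w s * G s| = `|2 * \sum_s w s * G s|.
  by rewrite normrM ger0_norm.
rewrite mulrCA -(sum_set_bit (fun s => w s * G s) k) -(sum_set_bit w k).
apply: le_trans (ler_norm_sum _ _ _) _.
rewrite mulr_sumr; apply: ler_sum => s _.
have -> : w (set_bit s k true) * G (set_bit s k true) +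
    w (set_bit s k false) * G (set_bit s k false) =
    (w (set_bit s k true) + w (set_bit s k false)) *
    (p s 0 k * G (set_bit s k true) + (1 - p s 0 k) * G (set_bit s k false)).
  have e : w (set_bit s k true) =
      p s 0 k * (w (set_bit s k true) + w (set_bit s k false)).
    have := p_conditional s k; lra.
  have e' : w (set_bit s k false) =
      (1 - p s 0 k) * (w (set_bit s k true) + w (set_bit s k false)).
    have := p_conditional s k; lra.
  by rewrite [in LHS]e [X in _ + X * _]e'; ring.
rewrite normrM ger0_norm ?addr_ge0// mulrC; apply: ler_wpM2r => //.
exact: addr_ge0.
Qed.

(** Given the other bits, [p s 0 k] and [d s] are constant and bit [k] has mean [p s 0 k]: all
    conditional means are 0. *)
Lemma sum_centered (d : {ffun 'I_n -> bool} -> R) k :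
  (forall s b, d (set_bit s k b) = d s) ->
  \sum_s w s * (((s k)%:R - p s 0 k) * d s) = 0.
Proof.
move=> dk; apply/eqP; rewrite -normr_le0.
apply: le_trans (sum_conditional_le (C := 0) (k := k) _) _; last first.
  by rewrite mul0r.
move=> s; rewrite !dk !p_set_bit !ffunE eqxx normr_le0 /=; apply/eqP; ring.
Qed.

Variables (f : 'rV[R]_n -> R) (f1 : 'I_n -> 'rV[R]_n -> R)
  (f2 : 'I_n -> 'I_n -> 'rV[R]_n -> R).
Hypothesis fC2 : C2_cube f f1 f2.
Let c i j := supnorm (f2 i j).
Variable delta : 'I_n -> 'I_n -> R.
Hypothesis p_variation : forall s k j,
  `|p (set_bit s k true) 0 j - p (set_bit s k false) 0 j| <= delta k j.

Lemma mean_field_error :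
  `|\sum_s w s * (f (vertex s) - f (p s))|
  <= (\sum_k (2^-1 * c k k + 4^-1 * \sum_j c j k * delta k j)) * \sum_s w s.
Proof.
under eq_bigr do rewrite telescope_hybrid mulr_sumr.
rewrite exchange_big/= mulr_suml; apply: le_trans (ler_norm_sum _ _ _) _.
apply: ler_sum => k _; apply: (sum_conditional_le (k := k)) => s.
rewrite !mxE !ffunE eqxx !p_set_bit /=.
set H1 := hybrid _ (p (set_bit s k true)) k.
set H0 := hybrid _ (p (set_bit s k false)) k.
have cH1 : cube H1 by apply: hybrid_cube => //; exact: vertex_cube.
have cH0 : cube H0 by apply: hybrid_cube => //; exact: vertex_cube.
have := p_cube s k; move: (p s 0 k) => q p01; have /andP[p0 p1] := p01.
have i1 : 0 <= (1 : R) <= 1 by rewrite lexx ler01.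
have i0 : 0 <= (0 : R) <= 1 by rewrite lexx ler01.
have z : \sum_j c j k * `|H0 0 j - H0 0 j| = 0.
  by apply: big1 => j _; rewrite subrr normr0 mulr0.
(* Both increments are linearized with the same slope [f1 k H0]; weighted by [q] and [1 - q], the
   linear parts [1 - q] and [- q] cancel. *)
have := C2_fiber_increment fC2 k cH1 cH0 p01 i1.
have := C2_fiber_increment fC2 k cH0 cH0 p01 i0.
rewrite -!/(c _ _) z addr0 sub0r normrN (ger0_norm p0).
rewrite (ger0_norm (_ : 0 <= 1 - q)); last lra.
set S := \sum_j c j k * `|H1 0 j - H0 0 j| => h0 h1.
have S_le : S <= \sum_j c j k * delta k j.
  apply: ler_sum => j _; apply: ler_wpM2l; first exact: (C2_norm_ge0 fC2).
  (* Coordinates below [k] are bits other than [k], equal in both hybrids; the rest come from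
     [p]. *)
  apply: le_trans (p_variation s k j); rewrite !mxE !ffunE.
  case: ifP => // jk; rewrite (_ : (j == k) = false) ?subrr ?normr0//.
  by apply: contraTF jk => /eqP ->; rewrite ltnn.
have S0 : 0 <= S.
  by apply: sumr_ge0 => j _; rewrite mulr_ge0//; exact: (C2_norm_ge0 fC2).
have c0 : 0 <= c k k by exact: (C2_norm_ge0 fC2).
apply: (@le_trans _ _ (2^-1 * c k k + 4^-1 * S)); last first.
  by rewrite lerD2l ler_wpM2l.
move: h0 h1; set G1 := f _ - _; set G0 := f _ - _; set K := f1 k H0.
rewrite !ler_norml => /andP[a1 a2] /andP[a3 a4].
(* The errors add up to [q * (1 - q) * (2 * c k k + S)], whence the constants 1/2 and 1/4. *)
have qq : q * (1 - q) <= 4^-1 by have := sqr_ge0 (q - 2^-1); nra.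
have qq0 : 0 <= q * (1 - q) by apply: mulr_ge0; lra.
have b1 := ler_wpM2l p0 a4; have b2 := ler_wpM2l p0 a3.
have p1' : 0 <= 1 - q by lra.
have b3 := ler_wpM2l p1' a2; have b4 := ler_wpM2l p1' a1.
have m1 : q * (1 - q) * (2 * c k k + S) <= 4^-1 * (2 * c k k + S).
  by apply: ler_wpM2r => //; lra.
by apply/andP; split; lra.
Qed.

End Conditional.

(** * Product measures and their entropy *)

Lemma sum_prod_bool (F : 'I_n -> bool -> R) :
  \sum_(s : {ffun 'I_n -> bool}) \prod_i F i (s i) =
  \prod_i (F i true + F i false).
Proof.
by rewrite -(bigA_distr_bigA F); apply: eq_bigr => i _; rewrite big_bool.
Qed.

Definition product_mass (x : 'rV[R]_n) s : R :=
  \prod_i bernoulli_mass (x 0 i) (s i).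

Lemma sum_product_mass x : \sum_s product_mass x s = 1.
Proof.
rewrite (sum_prod_bool (fun i => bernoulli_mass (x 0 i))).
by rewrite big1// => i _ /=; ring.
Qed.

Lemma product_mass_ge0 x s : cube x -> 0 <= product_mass x s.
Proof.
move=> cx; apply: prodr_ge0 => i _; rewrite /bernoulli_mass.
by have /andP[] := cx i; case: (s i) => *; lra.
Qed.

Lemma product_mass_set_bit x s k b :
  product_mass x (set_bit s k b) =
  bernoulli_mass (x 0 k) b * \prod_(i | i != k) bernoulli_mass (x 0 i) (s i).
Proof.
rewrite /product_mass (bigD1 k)//= !ffunE eqxx; congr (_ * _).
by apply: eq_bigr => i ik; rewrite ffunE (negPf ik).
Qed.

Lemma product_mass_conditional x s k :
  product_mass x (set_bit s k true) * (1 - x 0 k) =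
  product_mass x (set_bit s k false) * x 0 k.
Proof. by rewrite !product_mass_set_bit /=; ring. Qed.

Lemma ln_prod (F : 'I_n -> R) : (forall i, 0 < F i) ->
  ln (\prod_i F i) = \sum_i ln (F i).
Proof.
move=> F0; suff [_ //] : 0 < \prod_i F i /\ ln (\prod_i F i) = \sum_i ln (F i).
elim/big_rec2: _ => [|i y1 y2 _ [y0 <-]]; first by rewrite ltr01 ln1.
by rewrite mulr_gt0// lnM ?posrE.
Qed.

(** Where the mass vanishes both sides of the splitting are 0; elsewhere all factors are positive
    and [ln] splits. Averaging over bit [k] then leaves [entropy1 (x 0 k)]. *)
Lemma product_mass_entropy x : cube x ->
  \sum_s product_mass x s * ln (product_mass x s) = entropy x.
Proof.
move=> cx.
have E s : product_mass x s * ln (product_mass x s) =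
    \sum_i product_mass x s * ln (bernoulli_mass (x 0 i) (s i)).
  have [->|q0] := eqVneq (product_mass x s) 0.
    by rewrite mul0r big1// => i _; rewrite mul0r.
  rewrite -mulr_sumr ln_prod// => i.
  have /prodf_neq0/(_ i isT) := q0; rewrite lt_neqAle eq_sym => ->.
  rewrite /bernoulli_mass.
  by have /andP[] := cx i; case: (s i) => *; lra.
rewrite (eq_bigr _ (fun s _ => E s)) exchange_big/=; apply: eq_bigr => k _.
have := sum_set_bit (product_mass x) k.
have := sum_set_bit
  (fun s => product_mass x s * ln (bernoulli_mass (x 0 k) (s k))) k.
rewrite sum_product_mass.
have -> : \sum_s (product_mass x (set_bit s k true) *
      ln (bernoulli_mass (x 0 k) (set_bit s k true k)) +
    product_mass x (set_bit s k false) *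
      ln (bernoulli_mass (x 0 k) (set_bit s k false k))) =
    entropy1 (x 0 k) * \sum_s (product_mass x (set_bit s k true) +
                               product_mass x (set_bit s k false)).
  rewrite mulr_sumr; apply: eq_bigr => s _.
  by rewrite !product_mass_set_bit !ffunE eqxx /= /entropy1; ring.
by move=> h e; move: h; rewrite e; lra.
Qed.

(** Since [u * ln u >= u - 1], each coordinate contributes at least -1. This crude bound serves to
    show that the variational supremum is finite. *)
Lemma entropy_ge (x : 'rV[R]_n) : cube x -> - n%:R <= entropy x.
Proof.
move=> cx.
have le_xlnx (u : R) : 0 <= u -> u - 1 <= u * ln u.
  rewrite le_eqVlt => /predU1P[<-|u0]; first by rewrite mul0r; lra.
  have : ln u^-1 <= u^-1 - 1 by rewrite ln_leB1// invr_gt0.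
  rewrite lnV ?posrE// -(ler_pM2l u0) mulrBr divff ?gt_eqF//; lra.
have -> : - n%:R = \sum_(i < n) (-1 : R).
  by rewrite sumr_const card_ord mulNrn.
apply: ler_sum => i _; have /andP[x0 x1] := cx i.
have h0 := le_xlnx _ x0; have := le_xlnx (1 - x 0 i).
rewrite /entropy1; lra.
Qed.

End Discrete.

(** * The variational supremum and the lower bound *)

Section MeanField.
Context {R : realType} {n : nat}.
Variables (f : 'rV[R]_n -> R) (f1 : 'I_n -> 'rV[R]_n -> R)
  (f2 : 'I_n -> 'I_n -> 'rV[R]_n -> R).
Hypothesis fC2 : C2_cube f f1 f2.
Implicit Types (s : {ffun 'I_n -> bool}) (i j k : 'I_n) (x d : 'rV[R]_n).
Let a := supnorm f.
Let c i j := supnorm (f2 i j).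

Lemma variational_sup_ge x : cube x -> f x - entropy x <= variational_sup f.
Proof.
move=> cx; apply: ub_le_sup; last by exists x.
exists (a + n%:R) => _ [y cy <-].
have := supnorm_ge (C2_continuous fC2) cy; rewrite ler_norml => /andP[_ h].
have := entropy_ge cy; rewrite -/a in h; lra.
Qed.

Lemma log_partition_ge :
  variational_sup f - 2^-1 * \sum_i c i i <= log_partition f.
Proof.
suff : variational_sup f <= log_partition f + 2^-1 * \sum_i c i i by lra.
apply: ge_sup => [|_ [x cx <-]].
  by have [x cx] := @cube_neq0 R n; exists (f x - entropy x), x.
have q0 s := product_mass_ge0 s cx.
have q1 := sum_product_mass x.
have := gibbs_variational (fun s => f (vertex s)) q0 q1.
rewrite -/(log_partition f).
under eq_bigr do rewrite mulrBr.
rewrite sumrB product_mass_entropy//.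
(* The mean [x] is the same for all configurations, so [delta = 0]. *)
have e0 s k j : `|x 0 j - x 0 j| <= (0 : R) by rewrite subrr normr0.
have := mean_field_error q0 (fun=> cx) (fun _ _ _ => erefl)
  (product_mass_conditional x) fC2 (delta := fun _ _ => 0) e0.
rewrite q1 mulr1 -!/(c _ _).
under eq_bigr do rewrite mulrBr.
rewrite sumrB -mulr_suml q1 mul1r.
have -> : \sum_k (2^-1 * c k k + 4^-1 * \sum_j c j k * 0) = 2^-1 * \sum_k c k k.
  rewrite mulr_sumr; apply: eq_bigr => k _.
  by rewrite big1 ?mulr0 ?addr0// => j _; rewrite mulr0.
rewrite ler_norml => /andP[h _]; lra.
Qed.

(** Cauchy-Schwarz in the form [2 * |u| <= u^2 / eps + eps], summed over the coordinates. *)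
Lemma sum_le_of_sum_sqr_le (u : 'I_n -> R) (eps : R) : 0 < eps ->
  \sum_i u i ^+ 2 <= n%:R * eps ^+ 2 -> \sum_i `|u i| <= n%:R * eps.
Proof.
move=> e0 hu.
have le_i i : `|u i| <= 2^-1 * (u i ^+ 2 / eps + eps).
  rewrite -[u i ^+ 2]real_normK ?num_real//; move: `|u i| => v.
  rewrite -(ler_pM2l e0).
  have -> : eps * (2^-1 * (v ^+ 2 / eps + eps)) = 2^-1 * (v ^+ 2 + eps ^+ 2).
    by field; rewrite gt_eqF.
  have := sqr_ge0 (v - eps); lra.
apply: le_trans (ler_sum _ (fun i _ => le_i i)) _.
rewrite -mulr_sumr big_split/= -mulr_suml sumr_const card_ord -mulr_natl.
suff : (\sum_i u i ^+ 2) / eps <= n%:R * eps by lra.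
rewrite ler_pdivrMr//; lra.
Qed.

(** * The Gibbs measure and its conditional means *)

Let bit_derivative s i :=
  f (vertex (set_bit s i true)) - f (vertex (set_bit s i false)).

Let mean_field s : 'rV[R]_n := \row_i sigmoid (bit_derivative s i).

Let Z := \sum_s expR (f (vertex s)).

Let gibbs_mass s := expR (f (vertex s)) / Z.

Lemma bit_derivative_set_bit s k e :
  bit_derivative (set_bit s k e) k = bit_derivative s k.
Proof. by rewrite /bit_derivative !set_bitK. Qed.

Lemma mean_field_cube s : cube (mean_field s).
Proof. by move=> i; rewrite mxE !ltW ?sigmoid_gt0 ?sigmoid_lt1. Qed.

Lemma partition_gt0 : 0 < Z.
Proof.
rewrite /Z (bigD1 [ffun=> true])//= ltr_wpDr ?expR_gt0//.
by apply: sumr_ge0 => s _; exact: expR_ge0.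
Qed.

Lemma gibbs_mass_ge0 s : 0 <= gibbs_mass s.
Proof. by rewrite divr_ge0 ?expR_ge0// ltW// partition_gt0. Qed.

Lemma sum_gibbs_mass : \sum_s gibbs_mass s = 1.
Proof. by rewrite -mulr_suml divff// gt_eqF// partition_gt0. Qed.

Lemma ln_gibbs_mass s : ln (gibbs_mass s) = f (vertex s) - log_partition f.
Proof. by rewrite ln_div ?posrE ?expR_gt0 ?partition_gt0// expRK. Qed.

(** Setting bit [k] to true instead of false multiplies the Gibbs weight by
    [expR (bit_derivative s k)]. *)
Lemma mean_field_conditional s k :
  gibbs_mass (set_bit s k true) * (1 - mean_field s 0 k) =
  gibbs_mass (set_bit s k false) * mean_field s 0 k.
Proof.
rewrite mxE sigmoidC /sigmoid /gibbs_mass.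
have -> : expR (f (vertex (set_bit s k true))) =
    expR (f (vertex (set_bit s k false))) * expR (bit_derivative s k).
  by rewrite -expRD; congr expR; rewrite /bit_derivative; ring.
ring.
Qed.

Lemma mean_field_set_bit s k e :
  mean_field (set_bit s k e) 0 k = mean_field s 0 k.
Proof. by rewrite !mxE bit_derivative_set_bit. Qed.

(** As [sigmoid] is 1-Lipschitz, this reduces to a mixed second difference of [f] in directions [k]
    and [j]. *)
Lemma mean_field_variation s k j :
  `|mean_field (set_bit s k true) 0 j - mean_field (set_bit s k false) 0 j|
  <= c k j.
Proof.
rewrite !mxE; apply: le_trans (sigmoid_lipschitz _ _) _.
rewrite /bit_derivative !(vertex_set_bit _ j).
have i1 : 0 <= (1 : R) <= 1 by rewrite lexx ler01.
have i0 : 0 <= (0 : R) <= 1 by rewrite lexx ler01.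
apply: le_trans (C2_mixed_increment fC2 _ _ _ i0 i1) _; try exact: vertex_cube.
rewrite subr0 normr1 mulr1 (bigD1 k)//= big1 ?addr0.
  rewrite !mxE !ffunE eqxx subr0 normr1 mulr1//.
by move=> i ik; rewrite !mxE !ffunE (negPf ik) subrr normr0 mulr0.
Qed.

(** The right side is the log-likelihood of [s] under the product law with means [mean_field s]; the
    left side splits off its centered part. *)
Lemma mean_field_entropy s :
  entropy (mean_field s)
  + \sum_i ((s i)%:R - mean_field s 0 i) * bit_derivative s i
  = \sum_i ((s i)%:R * bit_derivative s i - softplus (bit_derivative s i)).
Proof.
rewrite -big_split/=; apply: eq_bigr => i _.
by rewrite mxE entropy1_sigmoid; ring.
Qed.

Lemma bit_derivative_partial s i :
  `|bit_derivative s i - f1 i (vertex s)| <= c i i.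
Proof.
have i1 : 0 <= (1 : R) <= 1 by rewrite lexx ler01.
have i0 : 0 <= (0 : R) <= 1 by rewrite lexx ler01.
have cs := @vertex_cube R n s.
have := C2_fiber_increment fC2 i cs cs i0 i1.
rewrite big1; last by move=> j _; rewrite subrr normr0 mulr0.
by rewrite /bit_derivative !vertex_set_bit subr0 normr1 !mulr1 addr0.
Qed.

(** A nonnegative number bounded by both [2 * a] and [S] is at most the square root of their
    product. *)
Lemma gibbs_mean_error :
  \sum_s gibbs_mass s * (f (vertex s) - f (mean_field s)) <=
  Num.sqrt (2 * a * \sum_k (2^-1 * c k k + 4^-1 * \sum_j c j k * c k j)).
Proof.
set e := (X in X <= _); set S := (X in 2 * a * X).
have e_S : e <= S.
  have := mean_field_error gibbs_mass_ge0 mean_field_cube mean_field_set_bit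
    mean_field_conditional fC2 mean_field_variation.
  by rewrite sum_gibbs_mass mulr1; apply: le_trans; exact: ler_norm.
have e_a : e <= 2 * a.
  apply: (@le_trans _ _ (\sum_s gibbs_mass s * (2 * a))); last first.
    by rewrite -mulr_suml sum_gibbs_mass mul1r.
  apply: ler_sum => s _; apply: ler_wpM2l; first exact: gibbs_mass_ge0.
  have := supnorm_ge (C2_continuous fC2) (vertex_cube s).
  have := supnorm_ge (C2_continuous fC2) (mean_field_cube s).
  by rewrite -/a !ler_norml => /andP[? ?] /andP[? ?]; lra.
have [e0|/ltW e0] := leP e 0; first exact: le_trans e0 (sqrtr_ge0 _).
rewrite -[e]ger0_norm// -sqrtr_sqr ler_wsqrtr// expr2.
exact: ler_pM.
Qed.

(** * The mixture over the net and the upper bound *)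

Section Net.
Variables (D : {fset 'rV[R]_n}) (eps : R).
Hypothesis eps_gt0 : 0 < eps.
Hypothesis D_net : forall s, exists2 d, d \in D &
  \sum_i (f1 i (vertex s) - d 0 i) ^+ 2 <= n%:R * eps ^+ 2.

Let tilt d : 'rV[R]_n := \row_i sigmoid (d 0 i).

Let mixture s := (#|` D|%:R)^-1 * \sum_(d <- D) product_mass (tilt d) s.

Lemma tilt_cube d : cube (tilt d).
Proof. by move=> i; rewrite mxE !ltW ?sigmoid_gt0 ?sigmoid_lt1. Qed.

Lemma net_card_gt0 : 0 < (#|` D|%:R : R).
Proof.
have [d dD _] := D_net [ffun=> true].
by rewrite ltr0n cardfs_gt0; apply/fset0Pn; exists d.
Qed.

Lemma sum_mixture : \sum_s mixture s = 1.
Proof.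
rewrite -mulr_sumr exchange_big/=.
under eq_bigr do rewrite sum_product_mass.
rewrite big_const_seq count_predT iter_addr_0 mulVf// gt_eqF//.
exact: net_card_gt0.
Qed.

Lemma bernoulli_sigmoid_gt0 u e : 0 < bernoulli_mass (sigmoid u) e :> R.
Proof.
by case: e; rewrite /bernoulli_mass ?sigmoid_gt0// subr_gt0 sigmoid_lt1.
Qed.

Lemma mixture_ge d s : d \in D ->
  (#|` D|%:R)^-1 * product_mass (tilt d) s <= mixture s.
Proof.
move=> dD; apply: ler_wpM2l; first by rewrite invr_ge0 ltW// net_card_gt0.
rewrite (bigD1_seq d) ?fset_uniq//= lerDl; apply: sumr_ge0 => d' _.
exact/product_mass_ge0/tilt_cube.
Qed.

Lemma product_mass_tilt_gt0 d s : 0 < product_mass (tilt d) s.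
Proof.
by apply: prodr_gt0 => i _; rewrite mxE bernoulli_sigmoid_gt0.
Qed.

Lemma mixture_gt0 s : 0 < mixture s.
Proof.
have [d dD _] := D_net s; apply: lt_le_trans (mixture_ge s dD).
by rewrite mulr_gt0 ?invr_gt0 ?net_card_gt0 ?product_mass_tilt_gt0.
Qed.

(** Keeping only the component of a net point [d] near the gradient at [s] costs [ln |D|]. Replacing
    [bit_derivative s i] by [d 0 i] via [f1 i] costs [c i i] plus a distance whose sum is at most
    [n * eps]. *)
Lemma ln_mixture_ge s :
  \sum_i ((s i)%:R * bit_derivative s i - softplus (bit_derivative s i))
  - (n%:R * eps + \sum_i c i i + ln #|` D|%:R) <= ln (mixture s).
Proof.
have [d dD /(sum_le_of_sum_sqr_le eps_gt0) hd] := D_net s.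
have : ln ((#|` D|%:R)^-1 * product_mass (tilt d) s) <= ln (mixture s).
  rewrite ler_ln ?posrE ?mixture_gt0 ?mixture_ge//.
  by rewrite mulr_gt0 ?invr_gt0 ?net_card_gt0 ?product_mass_tilt_gt0.
rewrite lnM ?posrE ?invr_gt0 ?net_card_gt0 ?product_mass_tilt_gt0//.
rewrite lnV ?posrE ?net_card_gt0// ln_prod; last first.
  by move=> i; rewrite mxE bernoulli_sigmoid_gt0.
suff : \sum_i ((s i)%:R * bit_derivative s i - softplus (bit_derivative s i))
    - \sum_i ln (bernoulli_mass (tilt d 0 i) (s i)) <=
    n%:R * eps + \sum_i c i i by lra.
apply: le_trans (lerD hd (lexx _)); rewrite -sumrB -big_split/=.
apply: ler_sum => i _; rewrite mxE -ln_bernoulli_sigmoid.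
apply: le_trans (ler_norm _) _.
apply: le_trans (ln_bernoulli_sigmoid_lipschitz _ _ _) _.
apply: le_trans (ler_distD (f1 i (vertex s)) _ _) _.
by rewrite [leRHS]addrC; apply: lerD (bit_derivative_partial _ _) _.
Qed.

Lemma log_partition_le :
  log_partition f <= variational_sup f
    + (n%:R * eps + \sum_i c i i + ln #|` D|%:R)
    + Num.sqrt (2 * a * \sum_k (2^-1 * c k k + 4^-1 * \sum_j c j k * c k j)).
Proof.
set err := (_ + ln _).
(* With energy [ln (mixture s)] the partition sum is 1, so this is nonnegativity of relative
   entropy. *)
have gibbs := gibbs_variational (fun s => ln (mixture s)) gibbs_mass_ge0
  sum_gibbs_mass.
have mixK s : expR (ln (mixture s)) = mixture s.
  by rewrite lnK// posrE mixture_gt0.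
rewrite (eq_bigr _ (fun s _ => mixK s)) sum_mixture ln1 in gibbs.
(* Pointwise, [f - entropy] at [mean_field s] is at most its supremum; the centered sum is kept
   because it vanishes only on average. *)
have le_s s : gibbs_mass s * (log_partition f - err - variational_sup f
     - (f (vertex s) - f (mean_field s))
     + \sum_i ((s i)%:R - mean_field s 0 i) * bit_derivative s i) <=
    gibbs_mass s * (ln (mixture s) - ln (gibbs_mass s)).
  apply: ler_wpM2l; first exact: gibbs_mass_ge0.
  rewrite ln_gibbs_mass; have := ln_mixture_ge s.
  rewrite -mean_field_entropy -/err.
  have := variational_sup_ge (mean_field_cube s); lra.
have {gibbs}le_s := le_trans (ler_sum _ (fun s _ => le_s s)) gibbs.
have centered : \sum_s gibbs_mass s *
    \sum_i ((s i)%:R - mean_field s 0 i) * bit_derivative s i = 0.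
  under eq_bigr do rewrite mulr_sumr.
  rewrite exchange_big/=; apply: big1 => k _.
  apply: (sum_centered gibbs_mass_ge0 mean_field_set_bit
    mean_field_conditional).
  by move=> s e; rewrite bit_derivative_set_bit.
move: le_s; under eq_bigr do rewrite mulrDr mulrBr.
rewrite big_split/= sumrB -mulr_suml sum_gibbs_mass mul1r centered.
have := gibbs_mean_error; lra.
Qed.

End Net.
End MeanField.

(** * Comparison with the stated error terms *)

Lemma sum_mul_transpose_le {R : realType} (n : nat) (c : 'I_n -> 'I_n -> R) :
  \sum_k \sum_j c j k * c k j <= \sum_k \sum_j c k j ^+ 2.
Proof.
have le_kj k j : c j k * c k j <= 2^-1 * c j k ^+ 2 + 2^-1 * c k j ^+ 2.
  by have := sqr_ge0 (c j k - c k j); lra.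
apply: le_trans (ler_sum _ (fun k _ => ler_sum _ (fun j _ => le_kj k j))) _.
under eq_bigr do rewrite big_split/= -!mulr_sumr.
rewrite big_split/= -!mulr_sumr [X in _ * X + _]exchange_big/=; lra.
Qed.

Lemma mean_error_le_smoothness {R : realType} (n : nat) (a : R) (b : 'I_n -> R)
    (c : 'I_n -> 'I_n -> R) :
  0 <= a -> (forall i, 0 <= b i) -> (forall i j, 0 <= c i j) ->
  \sum_i c i i
  + Num.sqrt (2 * a * \sum_k (2^-1 * c k k + 4^-1 * \sum_j c j k * c k j))
  <= smoothness_term a b c.
Proof.
move=> a0 b0 c0; rewrite /smoothness_term; set Q := (X in 4 * Num.sqrt X).
have sc0 : 0 <= \sum_i c i i by exact: sumr_ge0.
have l2 : 0 <= ln 2 :> R by rewrite ln_ge0// ler1n.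
have t0 : 0 <= 4^-1 * Num.sqrt (\sum_i b i ^+ 2) * Num.sqrt (\sum_i c i i ^+ 2).
  by rewrite !mulr_ge0 ?sqrtr_ge0// invr_ge0.
suff : Num.sqrt (2 * a * \sum_k (2^-1 * c k k + 4^-1 * \sum_j c j k * c k j))
    <= 4 * Num.sqrt Q by lra.
have -> : 4 * Num.sqrt Q = Num.sqrt (16 * Q).
  rewrite sqrtrM; last by lra.
  have -> : 16 = 4 ^+ 2 :> R by ring.
  by rewrite sqrtr_sqr ger0_norm.
apply: ler_wsqrtr; set S := \sum_k \sum_j c k j ^+ 2.
have S0 : 0 <= a * S.
  rewrite mulr_ge0// sumr_ge0// => k _.
  by rewrite sumr_ge0// => j _; exact: sqr_ge0.
(* It remains to compare [a * \sum_i c i i + a * S / 2] with 16 times this lower bound. *)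
have Q_ge : a * (\sum_i c i i) + 4^-1 * (a * S) <= Q.
  rewrite /Q /S !mulr_sumr; apply: lerD; apply: ler_sum => i _.
    by rewrite lerDl sqr_ge0.
  rewrite !mulr_sumr; apply: ler_sum => j _; apply: ler_wpM2l.
    by rewrite invr_ge0.
  by rewrite -addrA lerDl addr_ge0 ?mulr_ge0.
rewrite big_split/= -!mulr_sumr.
have /(ler_wpM2l a0) := sum_mul_transpose_le c; rewrite -/S.
have := mulr_ge0 a0 sc0; lra.
Qed.

Theorem theorem1p6 (R : realType) (n : nat) (n_ge1 : (1 <= n)%N)
    (f : 'rV[R]_n -> R) (f1 : 'I_n -> 'rV[R]_n -> R)
    (f2 : 'I_n -> 'I_n -> 'rV[R]_n -> R) (f_C2 : C2_cube f f1 f2)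
    (D : R -> {fset 'rV[R]_n}) (D_net : gradient_net f1 D) :
  let a := supnorm f in
  let b := fun i => supnorm (f1 i) in
  let c := fun i j => supnorm (f2 i j) in
  (forall eps : R, 0 < eps ->
     log_partition f <= variational_sup f
                        + complexity_term b D eps + smoothness_term a b c) /\
  log_partition f >= variational_sup f - 2^-1 * \sum_i c i i.
Proof.
move=> a b c; split; last exact: log_partition_ge f_C2.
move=> eps eps0; apply: le_trans (log_partition_le f_C2 eps0 (D_net _ eps0)) _.
have b0 i : 0 <= b i by apply/supnorm_ge0/(C2_partial_continuous f_C2).
have c0 i j : 0 <= c i j by exact: (C2_norm_ge0 f_C2).
have a0 : 0 <= a by apply/supnorm_ge0/(C2_continuous f_C2).
have := mean_error_le_smoothness a0 b0 c0; rewrite /complexity_term.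
(* The error [n * eps] and the logarithm fit in the complexity term, whose other parts are
   nonnegative. *)
have sb0 : 0 <= 4^-1 * Num.sqrt (n%:R * \sum_i b i ^+ 2) * eps.
  by rewrite !mulr_ge0 ?sqrtr_ge0 ?invr_ge0 ?(ltW eps0).
have neps0 : 0 <= n%:R * eps by rewrite mulr_ge0 ?ler0n ?(ltW eps0).
lra.
Qed.
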